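(* There exist constants $0<\varepsilon_0<\varepsilon_1<1$ such that any non-adaptive $(\varepsilon_0,\varepsilon_1)$-tolerant unateness tester for functions $f\colon\{0,1\}^n\to\{0,1\}$ must make $\widetilde{\Omega}(n^{3/2})$ queries.
   Context: A function $f\colon\{0,1\}^n\to\{0,1\}$ is unate if there is $r\in\{0,1\}^n$ such that $x\mapsto f(x\oplus r)$ is monotone with respect to the coordinatewise partial order. $\mathrm{dist}(f,g)=\Pr_{\boldsymbol x}[f(\boldsymbol x)\ne g(\boldsymbol x)]$ for uniform $\boldsymbol x\in\{0,1\}^n$, and $\mathrm{dist}(f,\mathcal P)=\min_{g\in\mathcal P}\mathrm{dist}(f,g)$. An $(\varepsilon_0,\varepsilon_1)$-tolerant tester for $\mathcal P$ accepts with probability at least $2/3$ if $\mathrm{dist}(f,\mathcal P)\le\varepsilon_0$ and rejects with probability at least $2/3$ if $\mathrm{dist}(f,\mathcal P)>\varepsilon_1$. Non-adaptive means all queries are fixed before any answers are seen. $\widetilde{\Omega}(f)$ means $\Omega(f/\log^c f)$ for an absolute constant $c$. *)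

(* Defs.v *)
From mathcomp Require Import all_boot all_order all_algebra.
From mathcomp Require Import reals.

Set Implicit Arguments.
Unset Strict Implicit.
Unset Printing Implicit Defensive.

Import Order.TTheory GRing.Theory Num.Theory.
Local Open Scope ring_scope.

Definition cube (n : nat) : finType := {ffun 'I_n -> bool}.

Definition boolfun (n : nat) : finType := {ffun cube n -> bool}.

Definition cube_xor n (x r : cube n) : cube n := [ffun i => x i (+) r i].

Definition cube_le n (x y : cube n) : bool := [forall i, x i ==> y i].

Definition monotone n (f : cube n -> bool) : bool :=
  [forall x : cube n, forall y : cube n, cube_le x y ==> (f x ==> f y)].

Definition unate n (f : boolfun n) : bool :=
  [exists r : cube n, monotone (fun x => f (cube_xor x r))].

Definition dist (R : realType) n (f g : boolfun n) : R :=
  #|[pred x : cube n | f x != g x]|%:R / #|cube n|%:R.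

(* Since dist f g <= 1, the default value 1 does not affect the minimum, for
   nonempty P. *)
Definition dist_to (R : realType) n (P : pred (boolfun n)) (f : boolfun n) : R :=
  \big[Order.min/1]_(g : boolfun n | P g) dist R f g.

(* A randomized non-adaptive algorithm: the queries depend on the random seed
   only, the verdict (true = accept) on the seed and the answers.  Finite seed
   spaces lose no generality: for bounded query size there are finitely many
   deterministic algorithms, and a randomized one is a distribution on them. *)
Record nonadaptive_algo (R : realType) (n : nat) := NonadaptiveAlgo {
  seed : finType;
  weight : seed -> R;
  weight_ge0 : forall s, 0 <= weight s;
  weight_sum1 : \sum_(s : seed) weight s = 1;
  queries : seed -> seq (cube n);
  verdict : seed -> seq bool -> bool
}.

Definition accepts (R : realType) n (A : nonadaptive_algo R n) (f : boolfun n)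
    (s : seed A) : bool :=
  verdict s [seq f x | x <- queries s].

Definition pr_accept (R : realType) n (A : nonadaptive_algo R n)
    (f : boolfun n) : R :=
  \sum_(s : seed A | accepts f s) weight s.

Definition pr_reject (R : realType) n (A : nonadaptive_algo R n)
    (f : boolfun n) : R :=
  \sum_(s : seed A | ~~ accepts f s) weight s.

Definition num_queries (R : realType) n (A : nonadaptive_algo R n) : nat :=
  \max_(s : seed A) size (queries s).

Definition tolerant_tester (R : realType) n (eps0 eps1 : R)
    (P : pred (boolfun n)) (A : nonadaptive_algo R n) : Prop :=
  forall f : boolfun n,
    (dist_to R P f <= eps0 -> 2 / 3 <= pr_accept A f) /\
    (eps1 < dist_to R P f -> 2 / 3 <= pr_reject A f).

(* Main.v *)
Require Import Defs.
From mathcomp Require Import all_boot all_order all_algebra.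
From mathcomp Require Import zify ring lra.
From mathcomp Require Import reals sequences exp.

Set Implicit Arguments.
Unset Strict Implicit.
Unset Printing Implicit Defensive.

(** Arrange [a * B] of the coordinates in [a] blocks of size [B].  A hidden
shift [s] designates one action coordinate per block, the others being control
coordinates.  There are [N = 2 ^ a / 2] terms, each a conjunction of one control
coordinate per block, chosen so that a constant fraction of the control
assignments satisfies exactly one term.  On a control assignment satisfying only
the term [i] the function is, outside the thin middle layers of the action cube,
the constant [b i] (yes-case) or [b i] xor the majority of the action bits (no-case),
for random bits [b].

The yes-functions are monotone up to the middle layers.  The no-functions
contain many copies of the majority and of its negation, and by Harris'
correlation inequality no choice of orientations suits both.

On a fixed query set the two distributions agree unless two queries satisfy a
common term and lie on opposite sides of the middle layers.  If the queries
differ in many coordinates they are unlikely to share a term, and if they differ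
in few they are unlikely to differ in many hidden action coordinates.  Hence the
number of queries is superpolynomial in [n], in particular larger than
[n ^ (3/2)]. *)

(** * Correlation of monotone and antitone functions *)

(** The map [(x, t) |-> (set x t, get x)] is an involution of [X * T]: overwriting part of a uniform
    point by fresh uniform data leaves it uniform. *)
Lemma lens_big (R : Type) (idx : R) (op : Monoid.com_law idx) (X T : finType)
    (get : X -> T) (set : X -> T -> X) (F : X -> R) :
  (forall x t, get (set x t) = t) -> (forall x t, set (set x t) (get x) = x) ->
  \big[op/idx]_x \big[op/idx]_t F (set x t) =
  \big[op/idx]_x \big[op/idx]_(t : T) F x.
Proof.
move=> gs ss; rewrite !pair_big /=.
pose h (p : X * T) := (set p.1 p.2, get p.1).
have hK : involutive h by case=> x t; rewrite /h /= gs ss.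
by rewrite [RHS](reindex_inj (inv_inj hK)); apply: eq_bigr => -[x t].
Qed.

Lemma lens_sum (X T : finType) (get : X -> T) (set : X -> T -> X) (F : X -> nat) :
  (forall x t, get (set x t) = t) -> (forall x t, set (set x t) (get x) = x) ->
  \sum_x \sum_t F (set x t) = #|T| * \sum_x F x.
Proof.
move=> gs ss; rewrite (lens_big _ F gs ss) big_distrr /=.
by apply: eq_bigr => x _; rewrite sum_nat_const.
Qed.

Lemma lens_sum_get (X T : finType) (get : X -> T) (set : X -> T -> X) (G : T -> nat) :
  (forall x t, get (set x t) = t) -> (forall x t, set (set x t) (get x) = x) ->
  #|X| * \sum_t G t = #|T| * \sum_x G (get x).
Proof.
move=> gs ss; rewrite -(lens_sum _ gs ss) -sum_nat_const.
by apply: eq_bigr => x _; apply: eq_bigr => t _; rewrite gs.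
Qed.

Lemma card_pred_sum (X : finType) (P : pred X) :
  #|[pred x | P x]| = \sum_x P x.
Proof. by rewrite -sum1_card big_mkcond; apply: eq_bigr => x _; rewrite inE; case: (P x). Qed.

Definition setb (I : finType) (z : {ffun I -> bool}) (i : I) (v : bool) :
    {ffun I -> bool} := [ffun j => if j == i then v else z j].

Lemma setb_get (I : finType) (z : {ffun I -> bool}) i v : setb z i v i = v.
Proof. by rewrite ffunE eqxx. Qed.

Lemma setbK (I : finType) (z : {ffun I -> bool}) i v : setb (setb z i v) i (z i) = z.
Proof. by apply/ffunP=> j; rewrite !ffunE; case: eqP => [->|]. Qed.

Definition inc_on a (P : pred 'I_a) (g : cube a -> bool) :=
  forall i z, P i -> g (setb z i false) -> g (setb z i true).

Definition dec_on a (P : pred 'I_a) (g : cube a -> bool) :=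
  forall i z, P i -> g (setb z i true) -> g (setb z i false).

Definition mix a (P : pred 'I_a) (m m' : cube a) : cube a :=
  [ffun i => if P i then m' i else m i].

Definition flip_on a (P : pred 'I_a) (m : cube a) : cube a := [ffun i => m i (+) P i].

Definition neg a (m : cube a) : cube a := [ffun i => ~~ m i].

Lemma neg_inv a : involutive (@neg a).
Proof. by move=> m; apply/ffunP=> i; rewrite !ffunE negbK. Qed.

Section Harris.
Variables (a : nat) (P : pred 'I_a) (g h : cube a -> bool).
Hypotheses (gdec : dec_on P g) (hinc : inc_on P h).

(** Swapping the [i]-th bits of [m] and [m'] exchanges the two mixtures. Adding each side to its
    swapped form leaves Chebyshev's inequality in one bit: oppositely monotone values have the
    larger sum of products when paired crosswise. *)
Lemma harris_step (Q : pred 'I_a) i : P i -> ~~ Q i ->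
  \sum_m \sum_m' (g m && h (mix Q m m')) <=
  \sum_m \sum_m' (g m && h (mix [pred j | (j == i) || Q j] m m')).
Proof.
move=> Pi nQi; set Q' := [pred j | _]; rewrite !pair_big /=.
pose sw (p : cube a * cube a) : cube a * cube a :=
  (setb p.1 i (p.2 i), setb p.2 i (p.1 i)).
have swK : involutive sw.
  case=> m m'; rewrite /sw /=; congr pair; apply/ffunP=> j; rewrite !ffunE eqxx;
  by case: eqP => [->|].
have mixQ p : mix Q (sw p).1 (sw p).2 = mix Q' p.1 p.2.
  apply/ffunP=> j; rewrite !ffunE /=; case: (eqVneq j i) => [->|_] //=.
  by rewrite (negbTE nQi).
have mixQ' p : mix Q' (sw p).1 (sw p).2 = mix Q p.1 p.2.
  by rewrite -mixQ swK.
rewrite -leq_double -!addnn.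
rewrite {2}(reindex_inj (inv_inj swK)) [in X in _ <= _ + X](reindex_inj (inv_inj swK)) /=.
rewrite -!big_split /=; apply: leq_sum => -[m m'] _.
rewrite mixQ mixQ' /=.
have mE : m = setb m i (m i) by apply/ffunP=> j; rewrite !ffunE; case: eqP => [->|].
have ME : mix Q m m' = setb (mix Q m m') i (m i).
  by apply/ffunP=> j; rewrite !ffunE; case: eqP => [->|] //; rewrite (negbTE nQi).
have ME' : mix Q' m m' = setb (mix Q m m') i (m' i).
  by apply/ffunP=> j; rewrite !ffunE /=; case: eqP => [->|].
have := @gdec i m Pi; have := @hinc i (mix Q m m') Pi.
have -> : g m = g (setb m i (m i)) by rewrite -mE.
have -> : h (mix Q m m') = h (setb (mix Q m m') i (m i)) by rewrite -ME.
rewrite ME'; case: (m i); case: (m' i) => //;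
move: (g (setb m i true)) (g (setb m i false)) (h (setb _ i true)) (h (setb _ i false));
case; case; case; case => // A B; first [by have := A isT | by have := B isT].
Qed.

(** The coordinates in [l] are resampled one by one inside [h], never lowering the sum. For [l]
    listing [P] this is Harris' inequality conditioned on the other coordinates. *)
Lemma harris (l : seq 'I_a) : uniq l -> all P l ->
  \sum_m \sum_(m' : cube a) (g m && h m) <=
  \sum_m \sum_m' (g m && h (mix [pred j | j \in l] m m')).
Proof.
elim: l => [_ _|i l IH /= /andP[il ul] /andP[Pi Pl]].
  rewrite leq_eqVlt; apply/orP; left; apply/eqP.
  apply: eq_bigr => m _; apply: eq_bigr => m' _.
  by congr (nat_of_bool (_ && h _)); apply/ffunP=> j; rewrite !ffunE inE.
apply: leq_trans (IH ul Pl) _; apply: leq_trans (@harris_step [pred j | j \in l] i Pi il) _.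
by apply: leq_sum => m _; apply: leq_sum => m' _.
Qed.

Lemma mix_involutive (Q : pred 'I_a) :
  involutive (fun p : cube a * cube a => (mix Q p.1 p.2, mix Q p.2 p.1)).
Proof.
by case=> m m' /=; congr pair; apply/ffunP=> j; rewrite !ffunE; case: (Q j).
Qed.

Lemma sum_mix (Q : pred 'I_a) (F : cube a -> nat) :
  \sum_m \sum_m' F (mix Q m m') = #|cube a| * \sum_m F m.
Proof.
rewrite pair_big big_distrr /= -(eq_bigr _ (fun m _ => sum_nat_const (mem (cube a)) (F m))).
rewrite pair_big /= [RHS](reindex_inj (inv_inj (mix_involutive Q))) /=.
by [].
Qed.

(* Conditioning on the coordinates outside [P], the correlation inequality
   gives Pr[g <> h] >= min(q, 1 - q) with q = Pr[h], whereas flipping the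
   coordinates in [P] changes h with probability at most 2 min(q, 1 - q). *)
Lemma dec_inc_dist :
  \sum_m (h m != h (flip_on P m)) <= 2 * \sum_m (g m != h m).
Proof.
pose M := #|cube a|; have M0 : 0 < M by apply/card_gt0P; exists [ffun=> false].
have Pm : forall m m', mix [pred j | j \in enum P] m m' = mix P m m'.
  by move=> m m'; apply/ffunP=> j; rewrite !ffunE /= mem_enum.
have H0 : \sum_m M * (g m && h m) <= \sum_m \sum_m' (g m && h (mix P m m')).
  have := @harris (enum P) (enum_uniq _).
  have -> : all P (enum P) by apply/allP=> j; rewrite mem_enum.
  move=> /(_ isT); under eq_bigr do rewrite sum_nat_const.
  by under [X in _ <= X -> _]eq_bigr do under eq_bigr do rewrite Pm.
(* Up to the factor [M], the conditional probability of [h] given the coordinates of [m] outside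
   [P]. *)
pose c m := \sum_m' h (mix P m m').
have cM m : c m <= M by rewrite /c /M -sum1_card; apply: leq_sum => m' _; case: (h _).
have H1 : \sum_m c m = M * \sum_m h m by rewrite /c (sum_mix P (fun m => h m : nat)).
have H2 : \sum_m M * (g m && h m) <= \sum_m g m * c m.
  apply: leq_trans H0 _; apply: leq_sum => m _.
  by rewrite big_distrr /=; apply: leq_sum => m' _; case: (g m); case: (h _).
have H3 : M * \sum_m (h m != h (flip_on P m)) <= \sum_m 2 * minn (c m) (M - c m).
  rewrite -(sum_mix P (fun m => (h m != h (flip_on P m)) : nat)).
  apply: leq_sum => m _.
  have fl m' : flip_on P (mix P m m') = mix P m (neg m').
    by apply/ffunP=> j; rewrite !ffunE; case: (P j); rewrite ?addbT ?addbF.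
  have cneg : c m = \sum_m' h (mix P m (neg m')).
    by rewrite /c (reindex_inj (inv_inj (@neg_inv a))).
  have cC : M - c m = \sum_m' ~~ h (mix P m m').
    rewrite /M -sum1_card -[RHS](addKn (c m)); congr (_ - _).
    by rewrite /c -big_split /=; apply: eq_bigr => m' _; case: (h _).
  have cCneg : M - c m = \sum_m' ~~ h (mix P m (neg m')).
    by rewrite cC (reindex_inj (inv_inj (@neg_inv a))).
  (* A change of [h] between a point and its flip needs a true value at one and a false value at the
     other, and both run over the same fibre. *)
  rewrite mul2n -addnn; case: (leqP (c m) (M - c m)) => _.
    rewrite {1}/c cneg -big_split /=; apply: leq_sum => m' _.
    by rewrite fl; do 2!case: (h _).
  rewrite {1}cC cCneg -big_split /=; apply: leq_sum => m' _.
  by rewrite fl; do 2!case: (h _).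
have H4 : \sum_m minn (c m) (M - c m) + 2 * \sum_m g m * c m <=
          \sum_m (M * g m + c m).
  rewrite big_distrr -big_split /=; apply: leq_sum => m _; have := cM m.
  by case: (g m) => /=; lia.
have H5 : \sum_m (g m != h m) + 2 * \sum_m (g m && h m) = \sum_m (g m : nat) + \sum_m (h m : nat).
  rewrite big_distrr -!big_split /=; apply: eq_bigr => m _.
  by case: (g m); case: (h m).
rewrite -(leq_pmul2l M0); apply: leq_trans H3 _; rewrite -big_distrr /=.
move: H4 H2; rewrite big_split /= H1 -!big_distrr /= => H4 H2.
rewrite mulnCA leq_mul2l /=.
have H6 : M * (\sum_m (g m != h m)) + 2 * (M * \sum_m (g m && h m)) =
  M * (\sum_m (g m : nat)) + M * (\sum_m (h m : nat)).
  by rewrite mulnCA -!mulnDr H5.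
move: H4 H2 H6; set u := M * _; set v := M * _; set w := M * _; set t := M * _.
by set p := \sum_m minn _ _; set q := \sum_m g m * c m; clear; lia.
Qed.
End Harris.

(** * Majority and the middle layers *)

Lemma leq_central_bin m j : 'C(m.*2, j) <= 'C(m.*2, m).
Proof.
have low i : i <= m -> 'C(m.*2, i) <= 'C(m.*2, m).
  move=> im; rewrite -(subKn im); elim: (m - i) => [|d IH]; first by rewrite subn0.
  apply: leq_trans IH; case: (leqP m d) => [md|dm].
    by have -> : m - d.+1 = m - d by lia.
  have -> : m - d = (m - d.+1).+1 by lia.
  rewrite -(leq_pmul2l (ltn0Sn (m - d.+1))) mul_bin_left leq_mul2r.
  by apply/orP; right; lia.
case: (leqP j m) => [/low //|mj]; case: (leqP j m.*2) => [jm|/bin_small -> //].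
by rewrite -bin_sub //; apply: low; lia.
Qed.

(** Integer form of [C(2m, m) <= 4^m / sqrt(2m+1)]. The ratio of consecutive central coefficients is
    [2(2m+1)/(m+1)], and [(2m+1)(2m+3) <= 4(m+1)^2]. *)
Lemma central_bin_sqr m : 'C(m.*2, m) ^ 2 * (m.*2).+1 <= 16 ^ m.
Proof.
elim: m => // m IH.
have E1 := mul_bin_diag (m.*2).+2 m; have E2 := mul_bin_down (m.*2).+1 m.
rewrite /= in E1 E2; rewrite doubleS (expnS 16).
move: E1 E2 IH; set x := 'C(_.+2, _); set y := 'C(_.+1, _); set z := 'C(_, _).
have -> : (m.*2).+1 - m = m.+1 by lia.
move=> E1 E2 IH.
have Ez : m.+1 * x = 2 * ((m.*2).+1 * z).
  by rewrite -E1 E2 mulnA mul2n doubleS.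
rewrite -(leq_pmul2l (ltn0Sn m)) -(leq_pmul2l (ltn0Sn m)).
have -> : m.+1 * (m.+1 * (x ^ 2 * (m.*2).+3)) = (m.+1 * x) ^ 2 * (m.*2).+3 by ring.
rewrite Ez.
have -> : (2 * ((m.*2).+1 * z)) ^ 2 * (m.*2).+3 =
  4 * ((m.*2).+1 * (m.*2).+3) * (z ^ 2 * (m.*2).+1) by ring.
have -> : m.+1 * (m.+1 * (16 * 16 ^ m)) = 16 * (m.+1 * m.+1) * 16 ^ m by ring.
by apply: leq_mul => //; nia.
Qed.

Definition wt a (z : cube a) : nat := \sum_i z i.

Lemma sum_wt_eq a j : \sum_(z : cube a) (wt z == j) <= 'C(a, j).
Proof.
rewrite -card_pred_sum; have := card_draws 'I_a j; rewrite card_ord => <-.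
pose f (z : cube a) := [set i | z i].
have finj : injective f.
  by move=> z z' /setP e; apply/ffunP=> i; have := e i; rewrite !inE.
rewrite -(card_imset _ finj); apply: subset_leq_card; apply/subsetP=> A.
case/imsetP=> z; rewrite !inE => /eqP <- ->.
by rewrite /wt -sum1_card big_mkcond /=; apply/eqP/eq_bigr => i _; rewrite inE; case: (z i).
Qed.

Definition mid a m k (z : cube a) := (m <= wt z + k) && (wt z <= m + k).
Definition maj a m (z : cube a) := m < wt z.

Lemma sum_mid m k : \sum_(z : cube m.*2) mid m k z <= k.*2.+1 * 'C(m.*2, m).
Proof.
apply: (@leq_trans (\sum_(z : cube m.*2) \sum_(d < k.*2.+1) (wt z + k == m + d))).
  apply: leq_sum => z _; rewrite /mid; case: andP => //= -[h1 h2].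
  have hd : wt z + k - m < k.*2.+1 by lia.
  by rewrite (bigD1 (Ordinal hd)) //= subnKC // eqxx.
rewrite exchange_big /= -[X in X * _]card_ord -sum_nat_const; apply: leq_sum => d _.
(* The index [d] stands for the weight [m + d - k]; for [m + d < k] there is no such layer. *)
case: (leqP k (m + d)) => [kd|kd].
  apply: leq_trans (leq_central_bin m (m + d - k)); apply: leq_trans (sum_wt_eq _ _).
  by apply: leq_sum => z _; rewrite -[wt z == _](eqn_add2r k) subnK.
by rewrite big1 // => z _; case: eqP => //; lia.
Qed.

Lemma sum_mid_sqr m k :
  (\sum_(z : cube m.*2) mid m k z) ^ 2 * (m.*2).+1 <= (k.*2.+1 * 2 ^ m.*2) ^ 2.
Proof.
apply: (@leq_trans (k.*2.+1 ^ 2 * ('C(m.*2, m) ^ 2 * (m.*2).+1))).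
  by rewrite mulnA -expnMn leq_mul2r leq_sqr sum_mid orbT.
rewrite expnMn leq_mul2l; apply/orP; right; apply: leq_trans (central_bin_sqr m) _.
by rewrite -[16]/(2 ^ 4) -!expnM leq_exp2l //; lia.
Qed.

Lemma wt_neg a (z : cube a) : wt z + wt (neg z) = a.
Proof.
rewrite /wt -big_split /= -[RHS]card_ord -sum1_card; apply: eq_bigr => i _.
by rewrite ffunE; case: (z i).
Qed.

Lemma maj_inc_on a m (P : pred 'I_a) : inc_on P (@maj a m).
Proof.
move=> i z _; rewrite /maj => /leq_trans; apply; rewrite /wt.
by apply: leq_sum => j _; rewrite !ffunE; case: eqP.
Qed.

Lemma card_cube a : #|cube a| = 2 ^ a.
Proof. by rewrite card_ffun card_bool card_ord. Qed.

(* Flipping first the coordinates outside [r], then those in [r], negates [z]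
   and hence changes the majority, unless [z] is balanced. *)
Lemma maj_flip_sum m k (r : cube m.*2) :
  2 ^ m.*2 <= \sum_(z : cube m.*2) (maj m z != maj m (flip_on [pred i | ~~ r i] z))
    + \sum_(z : cube m.*2) (maj m z != maj m (flip_on [pred i | r i] z))
    + \sum_(z : cube m.*2) mid m k z.
Proof.
set S := [pred i | ~~ r i].
have Sinj : injective (flip_on S).
  by apply: inv_inj => z; apply/ffunP=> i; rewrite !ffunE addbK.
rewrite [X in _ <= _ + X + _](reindex_inj Sinj) /= -card_cube -sum1_card -!big_split /=.
apply: leq_sum => z _.
have -> : flip_on [pred i | r i] (flip_on S z) = neg z.
  by apply/ffunP=> i; rewrite !ffunE /=; case: (r i); case: (z i).
have := wt_neg z; rewrite /mid /maj; move: (wt z) (wt (neg z)) (wt (flip_on S z)) => u v w.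
by move=> uv; case: (ltnP m u) => ?; case: (ltnP m w) => ?; case: (ltnP m v) => ? //=; lia.
Qed.

(** The pair [~~ G], [maj] is antitone and monotone on [P], so a function increasing on [P]
    approximates negated majority only if flipping [P] rarely changes the majority. *)
Lemma inc_maj_neg_dist m (P : pred 'I_m.*2) (G : cube m.*2 -> bool) : inc_on P G ->
  \sum_z (maj m z != maj m (flip_on P z)) <= 2 * \sum_z (G z != ~~ maj m z).
Proof.
move=> Gi; pose g z := ~~ G z.
have gd : dec_on P g.
  by move=> i z Pi; rewrite /g; apply: contra; apply: Gi.
apply: leq_trans (@dec_inc_dist _ P g (maj m) gd (@maj_inc_on _ m P)) _.
by rewrite leq_mul2l /=; apply: leq_sum => z _; rewrite /g; case: (G z); case: (maj _ _).
Qed.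

Lemma dec_maj_dist m (P : pred 'I_m.*2) (G : cube m.*2 -> bool) : dec_on P G ->
  \sum_z (maj m z != maj m (flip_on P z)) <= 2 * \sum_z (G z != maj m z).
Proof. by move=> gd; exact: (@dec_inc_dist _ P G (maj m) gd (@maj_inc_on _ m P)). Qed.

(** * Control terms *)

Lemma nat_forall (I : finType) (P : pred I) : [forall i, P i] = \prod_i P i :> nat.
Proof.
case: forallP => [h|/forallP]; first by rewrite big1 // => i _; rewrite h.
by rewrite negb_forall => /existsP[i /negbTE ni]; rewrite (bigD1 i) //= ni.
Qed.

Lemma expn_prod x a : x ^ a = \prod_(j < a) x.
Proof. by rewrite prod_nat_const card_ord. Qed.

Lemma sum_coord B (c : 'I_B) : 2 * \sum_(u : cube B) u c = 2 ^ B.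
Proof.
have := @lens_sum_get (cube B) bool (fun u => u c) (fun u => setb u c) nat_of_bool
  (fun u => setb_get u c) (fun u => setbK u c).
by rewrite big_bool card_bool card_cube /= addn0 muln1 => <-.
Qed.

Lemma sum_coord2 B (c d : 'I_B) :
  4 * \sum_(u : cube B) (u c && u d) = 2 ^ B * (1 + (c == d)).
Proof.
case: (eqVneq c d) => [<-|cd].
  by under eq_bigr do rewrite andbb; rewrite -(mulnA 2 2) sum_coord mulnC.
rewrite -(mulnA 2 2) muln1; have := @lens_sum (cube B) bool (fun u => u c)
  (fun u => setb u c) (fun u => u c && u d) (fun u => setb_get u c) (fun u => setbK u c).
rewrite card_bool => <-; rewrite -(sum_coord d); congr (_ * _); apply: eq_bigr => u _.
by rewrite big_bool /= !setb_get ffunE eq_sym (negbTE cd) addn0.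
Qed.

Section Terms.
Variables a B0 : nat.

Definition blocks : finType := {ffun 'I_a -> cube B0}.
Definition term : finType := {ffun 'I_a -> 'I_B0}.

Definition sat (t : term) (y : blocks) := [forall j, y j (t j)].

(** Equals 2 to the number of shared coordinates, the factor by which the probability that both
    terms hold exceeds [4^(-a)]. *)
Definition overlap (t t' : term) := \prod_j (1 + (t j == t' j)).

Lemma card_blocks : #|blocks| = (2 ^ B0) ^ a.
Proof. by rewrite card_ffun card_cube card_ord. Qed.

Lemma sum_sat2 t t' :
  4 ^ a * \sum_y (sat t y && sat t' y) = #|blocks| * overlap t t'.
Proof.
under eq_bigr => y _.
  have -> : sat t y && sat t' y = \prod_j (y j (t j) && y j (t' j)) :> nat.
    rewrite -nat_forall; congr nat_of_bool; apply/andP/forallP.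
      by move=> [/forallP h /forallP h'] j; rewrite h h'.
    by move=> h; split; apply/forallP=> j; case/andP: (h j).
over.
rewrite -(bigA_distr_bigA (fun j u => nat_of_bool ((u : cube B0) (t j) && u (t' j)))) /=.
rewrite card_blocks /overlap (expn_prod 4) (expn_prod (2 ^ B0)) -!big_split /=.
by apply: eq_bigr => j _; rewrite sum_coord2.
Qed.

Lemma sum_sat t : 2 ^ a * \sum_y sat t y = #|blocks|.
Proof.
have := sum_sat2 t t; under eq_bigr do rewrite andbb.
have -> : overlap t t = 2 ^ a.
  by rewrite /overlap; under eq_bigr do rewrite eqxx; rewrite prod_nat_const card_ord.
rewrite (expnMn 2 2) [in RHS]mulnC -mulnA => /eqP.
by rewrite eqn_pmul2l ?expn_gt0 // => /eqP.
Qed.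

Lemma sum_overlap t : \sum_t' overlap t t' = B0.+1 ^ a.
Proof.
rewrite -(bigA_distr_bigA (fun j c => 1 + (t j == c))) /=.
under eq_bigr => j _.
  rewrite big_split /= sum1_card card_ord (bigD1 (t j)) //= eqxx big1 ?addn0 ?addn1.
  over.
  by move=> c; rewrite eq_sym => /negbTE ->.
by rewrite prod_nat_const card_ord.
Qed.

Lemma overlap_sym t t' : overlap t t' = overlap t' t.
Proof. by apply: eq_bigr => j _; rewrite eq_sym. Qed.

Lemma exists_below_average (X : finType) (f : X -> nat) : 0 < #|X| ->
  exists x, #|X| * f x <= \sum_x f x.
Proof.
case/card_gt0P=> x0 _; case: (@arg_minnP X x0 predT f isT) => x _ xmin.
by exists x; rewrite -sum_nat_const; apply: leq_sum => x' _; apply: xmin.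
Qed.

(** Terms are added greedily, each with at most average total overlap with its predecessors. The
    right side collects [N] diagonal overlaps [2^a] and [N^2] average ones, scaled by [B0^a]. *)
Lemma exists_terms N : 0 < B0 -> exists T : nat -> term,
  B0 ^ a * \sum_(i < N) \sum_(j < N) overlap (T i) (T j) <=
  N * (2 ^ a * B0 ^ a) + N ^ 2 * B0.+1 ^ a.
Proof.
move=> B0p; have cT : #|term| = B0 ^ a by rewrite card_ffun !card_ord.
elim: N => [|N [T IH]].
  by exists (fun _ => [ffun=> Ordinal B0p]); rewrite big_ord0 muln0.
have [|t] := @exists_below_average term (fun t => \sum_(i < N) overlap (T i) t).
  by rewrite cT expn_gt0 B0p.
rewrite cT exchange_big /=; under [X in _ <= X]eq_bigr do rewrite sum_overlap.
rewrite sum_nat_const card_ord => ht.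
exists (fun i => if i == N then t else T i).
rewrite big_ord_recr /= eqxx.
under eq_bigr => i _ do rewrite big_ord_recr /= eqxx (ltn_eqF (ltn_ord i)).
rewrite big_ord_recr /= eqxx big_split /=.
under [X in X + _ + _]eq_bigr do under eq_bigr => j _ do rewrite (ltn_eqF (ltn_ord j)).
under [X in _ + (X + _)]eq_bigr => j _ do rewrite (ltn_eqF (ltn_ord j)) overlap_sym.
have -> : overlap t t = 2 ^ a.
  by rewrite /overlap; under eq_bigr do rewrite eqxx; rewrite prod_nat_const card_ord.
move: IH ht; set S := \sum_(i < N) \sum_(j < N) _; set C := \sum_(i < N) _.
by move: (B0 ^ a) (B0.+1 ^ a) (2 ^ a) => p q r; clear; nia.
Qed.
End Terms.

(** Bernoulli's inequality [(1 - 1/(x+1))^a >= 1 - a/(x+1)] with denominators cleared. *)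
Lemma bernoulli_nat x a : a <= x -> x.+1 ^ a * (x.+1 - a) <= x ^ a * x.+1.
Proof.
elim: a => [|a IH] ax; first by rewrite subn0.
rewrite !expnS; have := IH (ltnW ax).
have -> : x.+1 - a = (x.+1 - a.+1).+1 by lia.
have : x.+1 - a.+1 <= x by lia.
move: (x.+1 ^ a) (x ^ a) (x.+1 - a.+1) => p q r; nia.
Qed.

Lemma exp_ratio x a : 20 * a <= x -> 19 * x.+1 ^ a <= 20 * x ^ a.
Proof.
move=> ax; have := @bernoulli_nat x a ltac:(lia); have : 19 * x.+1 <= 20 * (x.+1 - a) by lia.
move: (x.+1 ^ a) (x ^ a) (x.+1 - a) => p q r h1 h2.
by rewrite -(leq_pmul2r (ltn0Sn x)); nia.
Qed.

(** * Control assignments satisfying exactly one term *)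

Section Window.
Variables a B0 N : nat.
Variable T : 'I_N -> term a B0.

(** Caps the product of block weights at 16 times about its mean. The successor covers the action
    bit, so the cap extends to whole blocks. Its failure is an increasing event, which suits the
    monotone yes-functions. *)
Definition window (y : blocks a B0) :=
  2 ^ a * \prod_j (wt (y j)).+1 <= 16 * B0.+1 ^ a.

Definition nsat (y : blocks a B0) := \sum_i sat (T i) y.

Lemma sum_wtS : 2 * \sum_(u : cube B0) (wt u).+1 = 2 ^ B0 * B0.+2.
Proof.
under eq_bigr do rewrite -addn1.
rewrite big_split /= sum1_card card_cube /wt exchange_big /= mulnDr big_distrr /=.
under eq_bigr do rewrite sum_coord.
by rewrite sum_nat_const card_ord; ring.
Qed.

Lemma sum_window_prod :
  2 ^ a * \sum_(y : blocks a B0) \prod_j (wt (y j)).+1 = #|blocks a B0| * B0.+2 ^ a.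
Proof.
rewrite -(bigA_distr_bigA (fun (j : 'I_a) (u : cube B0) => (wt u).+1)) /=.
rewrite card_blocks (expn_prod 2) (expn_prod (2 ^ B0)) (expn_prod B0.+2 a) -!big_split /=.
by apply: eq_bigr => j _; rewrite sum_wtS.
Qed.

Lemma sum_not_window :
  16 * B0.+1 ^ a * \sum_y (~~ window y) <= #|blocks a B0| * B0.+2 ^ a.
Proof.
rewrite -sum_window_prod !big_distrr /=; apply: leq_sum => y _.
by rewrite /window -ltnNge; case: ltnP => [/ltnW|] //; rewrite ?muln1 ?muln0.
Qed.

Lemma sum_nsat : 2 ^ a * \sum_y nsat y = N * #|blocks a B0|.
Proof.
rewrite /nsat exchange_big /= big_distrr /=.
by under eq_bigr do rewrite sum_sat; rewrite sum_nat_const card_ord.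
Qed.

Lemma sum_nsat_sqr :
  4 ^ a * \sum_y nsat y ^ 2 = #|blocks a B0| * \sum_i \sum_j overlap (T i) (T j).
Proof.
under eq_bigr do rewrite /nsat -mulnn big_distrlr /=.
rewrite exchange_big /= !big_distrr /=; apply: eq_bigr => i _.
rewrite exchange_big /= !big_distrr /=; apply: eq_bigr => j _.
by rewrite -sum_sat2; congr (_ * _); apply: eq_bigr => y _; rewrite mulnb.
Qed.

Definition unique_mass := \sum_y (window y && (nsat y == 1)).

(* Second moment: 1[Z = 1] >= 2 Z - Z^2 for Z = nsat y, whose mean is 1/2. *)
Lemma unique_mass_ge : 20 * a <= B0 -> 0 < B0 -> 2 * N = 2 ^ a ->
  B0 ^ a * \sum_i \sum_j overlap (T i) (T j) <= N * (2 ^ a * B0 ^ a) + N ^ 2 * B0.+1 ^ a ->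
  #|blocks a B0| <= 8 * unique_mass.
Proof.
move=> aB B0p N2 hT.
have r1 := exp_ratio aB; have r2 := @exp_ratio B0.+1 a (leqW aB).
have p0 : 0 < B0 ^ a by rewrite expn_gt0 B0p.
have p1 : 0 < B0.+1 ^ a by rewrite expn_gt0.
have N0 : 0 < N by have : 0 < 2 ^ a by [rewrite expn_gt0]; lia.
have h1 := sum_nsat; have h2 := sum_nsat_sqr; have h3 := sum_not_window.
have h4 : 2 * \sum_y nsat y <= \sum_y nsat y ^ 2 + (unique_mass + \sum_y (~~ window y)).
  rewrite /unique_mass big_distrr -!big_split /=; apply: leq_sum => y _.
  case: (window y) => /=; case: (nsat y) => [|[|z]] //=; nia.
move: h1 h2 h3 h4 hT; rewrite (expnMn 2 2) -N2.
move: #|_| unique_mass (\sum_y nsat y) (\sum_y nsat y ^ 2) (\sum_y (~~ window y)) => Y U s1 s2 f.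
move: (\sum_i _) r1 r2 p0 p1 N0; clear.
move: (B0 ^ a) (B0.+1 ^ a) (B0.+2 ^ a) => p q r o r1 r2 p0 p1 N0 h1 h2 h3 h4 hT.
have k1 : 2 * s1 = Y.
  by apply/eqP; rewrite -(eqn_pmul2l N0); apply/eqP; rewrite -h1; ring.
(* In units of [Y], the diagonal overlaps contribute 2 to [4 * s2] and the average ones at most
   [20/19], in total [58/19]. *)
have k2 : 19 * (4 * s2) <= 58 * Y.
  have A : N * N * (p * (4 * s2)) = Y * (p * o).
    have -> : N * N * (p * (4 * s2)) = p * (2 * N * (2 * N) * s2) by ring.
    by rewrite h2; ring.
  have B : Y * (p * o) <= Y * (N * N * (2 * p + q)).
    by rewrite leq_mul2l; apply/orP; right; apply: leq_trans hT _; apply: eq_leq; ring.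
  have C : p * (4 * s2) <= Y * (2 * p + q).
    rewrite -(leq_pmul2l (_ : 0 < N * N)) ?muln_gt0 ?N0 // A.
    by apply: leq_trans B _; apply: eq_leq; ring.
  rewrite -(leq_pmul2l p0).
  have D : Y * (19 * (2 * p + q)) <= Y * (58 * p) by rewrite leq_mul2l; apply/orP; right; lia.
  have E : 19 * (p * (4 * s2)) <= 19 * (Y * (2 * p + q)) by rewrite leq_mul2l C orbT.
  nia.
have k3 : 19 * 16 * f <= 20 * Y.
  rewrite -(leq_pmul2l p1).
  have D : Y * (19 * r) <= Y * (20 * q) by rewrite leq_mul2l r2 orbT.
  nia.
(* There remains [1 - 58/76 - 20/304 = 52/304] of [Y], more than an eighth. *)
lia.
Qed.

Lemma unique_mass_split :
  unique_mass = \sum_i \sum_y [&& window y, nsat y == 1 & sat (T i) y].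
Proof.
rewrite exchange_big /=; apply: eq_bigr => y _.
case: (boolP (window y && (nsat y == 1))) => /=.
  case/andP=> -> e; rewrite -[LHS](eqP e) {1}/nsat; apply: eq_bigr => i _.
  by rewrite e.
by move=> h; rewrite big1 // => i _; rewrite andbA (negbTE h).
Qed.
End Window.

(** * Balance of random signs *)

Section Balance.
Import GRing.Theory Num.Theory Order.TTheory.
Local Open Scope ring_scope.
Variables (N : nat) (v : 'I_N -> nat).

Let sg (b : bool) : int := if b then 1 else - 1.

(** Flipping [b i] negates every off-diagonal product, so only the squares survive. *)
Lemma sum_sign_sqr :
  \sum_(b : cube N) (\sum_i sg (b i) * (v i)%:Z) ^+ 2 = (2 ^ N * \sum_i v i ^ 2)%N%:Z.
Proof.
under [LHS]eq_bigr do rewrite expr2 big_distrlr /=.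
rewrite exchange_big /= PoszM -[X in _ = _ * X]natz natr_sum mulr_sumr; apply: eq_bigr => i _.
rewrite exchange_big /= (bigD1 i) //= [X in _ + X]big1 ?addr0.
  under eq_bigr => b _.
    have -> : sg (b i) * (v i)%:Z * (sg (b i) * (v i)%:Z) = (v i ^ 2)%N%:Z.
      by rewrite /sg; case: (b i); rewrite -mulnn PoszM; ring.
  over.
  by rewrite sumr_const card_cube !natz -[LHS]mulr_natl natz.
move=> j ji.
pose fl (b : cube N) : cube N := setb b i (~~ b i).
have flK : involutive fl.
  by move=> b; apply/ffunP=> l; rewrite !ffunE eqxx negbK; case: eqP => [->|].
set S := (X in X = _); have : S = - S.
  rewrite /S {1}(reindex_inj (inv_inj flK)) /= -sumrN; apply: eq_bigr => b _.
  by rewrite !ffunE eqxx (negbTE ji) /sg; case: (b i) => /=; ring.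
by move=> /eqP; rewrite -addr_eq0 -mulr2n mulrn_eq0 => /eqP.
Qed.

(** Chebyshev's inequality: if one side gets less than a quarter of the total, the signed sum
    exceeds half of it in absolute value, while its second moment is at most [1/C] of the squared
    total. *)
Lemma balanced_split C : (0 < \sum_i v i)%N -> (forall i, C * v i <= \sum_i v i)%N ->
  (C * \sum_(b : cube N) ((4 * \sum_i b i * v i < \sum_i v i) ||
     (4 * \sum_i (~~ b i) * v i < \sum_i v i)) <= 4 * 2 ^ N)%N.
Proof.
move=> V0 hC; set V := (\sum_i v i)%N in V0 hC *.
pose bad (b : cube N) := (4 * \sum_i b i * v i < V)%N || (4 * \sum_i (~~ b i) * v i < V)%N.
have h1 (b : cube N) : ((bad b * V ^ 2)%N%:Z <= 4 * (\sum_i sg (b i) * (v i)%:Z) ^+ 2).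
  set p := (\sum_i b i * v i)%N; set q := (\sum_i (~~ b i) * v i)%N.
  have pq : (p + q = V)%N.
    by rewrite /p /q -big_split /=; apply: eq_bigr => i _; case: (b i); rewrite /= ?mul1n ?mul0n ?addn0.
  have -> : \sum_i sg (b i) * (v i)%:Z = p%:Z - q%:Z.
    rewrite /p /q -[X in _ = X - _]natz -[X in _ = _ - X]natz !natr_sum -sumrB; apply: eq_bigr => i _.
    by rewrite /sg !natz; case: (b i); rewrite /= ?mul1n ?mul0n; ring.
  rewrite /bad -/p -/q; case: (boolP (_ || _)) => /= hb; last by rewrite mul0n; nia.
  by rewrite mul1n -pq; nia.
have h2 : ((V ^ 2 * \sum_b bad b)%N%:Z <= (4 * (2 ^ N * \sum_i v i ^ 2))%N%:Z).
  rewrite PoszM [X in _ <= X]PoszM -sum_sign_sqr mulr_sumr -[X in _ * X <= _]natz natr_sum mulr_sumr.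
  by apply: ler_sum => b _; apply: le_trans (h1 b); rewrite natz -PoszM mulnC.
move: h2; rewrite lez_nat => h2.
have h3 : (C * \sum_i v i ^ 2 <= V ^ 2)%N.
  rewrite -mulnn {2}/V !big_distrr /=; apply: leq_sum => i _.
  by rewrite -mulnn mulnA leq_mul2r hC orbT.
have V2 : (0 < V ^ 2)%N by rewrite expn_gt0 V0.
rewrite -(leq_pmul2l V2); rewrite -/(bad _).
have h4 : (C * (V ^ 2 * \sum_b bad b) <= C * (4 * (2 ^ N * \sum_i v i ^ 2)))%N by rewrite leq_mul2l h2 orbT.
have h5 : (4 * 2 ^ N * (C * \sum_i v i ^ 2) <= 4 * 2 ^ N * V ^ 2)%N by rewrite leq_mul2l h3 orbT.
rewrite mulnCA; apply: leq_trans h4 _; rewrite [X in (_ <= X)%N]mulnC; apply: leq_trans h5.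
by apply: eq_leq; ring.
Qed.
End Balance.

(** * The hard functions *)

Section Restriction.
Variables (n : nat) (J : finType) (phi : J -> 'I_n).

Definition pull (x : cube n) : {ffun J -> bool} := [ffun j => x (phi j)].

Definition push (x : cube n) (w : {ffun J -> bool}) : cube n :=
  [ffun i => if [pick j | phi j == i] is Some j then w j else x i].

Hypothesis phi_inj : injective phi.

Lemma pushE x w j : push x w (phi j) = w j.
Proof.
by rewrite ffunE; case: pickP => [j' /eqP/phi_inj -> //|/(_ j)]; rewrite eqxx.
Qed.

Lemma pull_push x w : pull (push x w) = w.
Proof. by apply/ffunP=> j; rewrite ffunE pushE. Qed.

Lemma push_pull x w : push (push x w) (pull x) = x.
Proof.
apply/ffunP=> i; rewrite ffunE; case: pickP => [j /eqP <-|h]; first by rewrite ffunE.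
by rewrite ffunE; case: pickP => // j; rewrite h.
Qed.

Lemma push_setb x w j v : push x (setb w j v) = setb (push x w) (phi j) v.
Proof.
apply/ffunP=> i; rewrite !ffunE; case: pickP => [j' /eqP <-|h]; rewrite ?ffunE.
  by rewrite (inj_eq phi_inj).
by rewrite eq_sym (h j).
Qed.
End Restriction.

Lemma unate_oriented n (g : boolfun n) : unate g ->
  exists r : cube n, inc_on [pred i | ~~ r i] g /\ dec_on [pred i | r i] g.
Proof.
case/existsP=> r /forallP gm; exists r.
have le x y : cube_le (cube_xor x r) (cube_xor y r) -> g x -> g y.
  have xorK (w : cube n) : cube_xor (cube_xor w r) r = w.
    by apply/ffunP=> i; rewrite !ffunE addbK.
  move=> xy; have /forallP/(_ (cube_xor y r)) := gm (cube_xor x r).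
  by rewrite xy /= !xorK => /implyP.
split=> i z /= ri; apply: le; apply/forallP=> j; rewrite !ffunE;
  by case: eqP => [->|_]; rewrite ?ri ?(negbTE ri) ?implybb.
Qed.

Section Hard.
Variables (m k B0 N n : nat).
Local Notation a := m.*2.
Variable T : 'I_N -> term a B0.
Variable iota : 'I_a * 'I_B0.+1 -> 'I_n.
Hypothesis iota_inj : injective iota.

Definition shift : finType := {ffun 'I_a -> 'I_B0.+1}.

Definition act_coord (s : shift) (j : 'I_a) : 'I_n := iota (j, s j).
(** Since [lift ord0] ranges over the nonzero residues modulo [B0 + 1], the control bits avoid the
    action bit, and under a uniform shift each is uniform in its block. *)
Definition ctl_coord (s : shift) (p : 'I_a * 'I_B0) : 'I_n :=
  iota (p.1, (s p.1 + lift ord0 p.2)%R).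

Definition act (s : shift) (x : cube n) : cube a := pull (act_coord s) x.
Definition ctl (s : shift) (x : cube n) : blocks a B0 :=
  [ffun j => [ffun c => pull (ctl_coord s) x (j, c)]].

Lemma act_coord_inj s : injective (act_coord s).
Proof. by move=> j j' /iota_inj[]. Qed.

Lemma ctl_coord_inj s : injective (ctl_coord s).
Proof. move=> [j c] [j' c'] /iota_inj e; move: (congr1 fst e) (congr1 snd e) => /= <- e2.
by have /lift_inj -> := GRing.addrI (s j) e2. Qed.

Lemma ctl_act_coord s p j : act_coord s j != ctl_coord s p.
Proof.
apply/negP=> /eqP/iota_inj e; move: (congr1 fst e) (congr1 snd e) => /= <-.
rewrite -[LHS]GRing.addr0 => {}e.
by have := GRing.addrI (s j) e; apply/eqP; apply: neq_lift.
Qed.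

Lemma act_push s x z : act s (push (act_coord s) x z) = z.
Proof. exact: pull_push (@act_coord_inj s) x z. Qed.

Lemma ctl_push s x z : ctl s (push (act_coord s) x z) = ctl s x.
Proof.
apply/ffunP=> j; apply/ffunP=> c; rewrite !ffunE.
by case: pickP => // j' /eqP e; case/negP: (ctl_act_coord s (j, c) j'); apply/eqP.
Qed.

Lemma sum_act s (G : cube a -> nat) :
  #|cube n| * \sum_z G z = 2 ^ a * \sum_x G (act s x).
Proof.
rewrite -card_cube; apply: (@lens_sum_get _ _ (act s) (push (act_coord s))).
  exact: act_push.
by move=> x z; apply: push_pull; apply: act_coord_inj.
Qed.

Lemma sum_act_push s (P : cube n -> nat) :
  \sum_x \sum_z P (push (act_coord s) x z) = 2 ^ a * \sum_x P x.
Proof.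
rewrite -card_cube; apply: (@lens_sum _ _ (act s)); first exact: act_push.
by move=> x z; apply: push_pull; apply: act_coord_inj.
Qed.

Lemma sum_ctl s (G : blocks a B0 -> nat) :
  #|cube n| * \sum_y G y = #|blocks a B0| * \sum_x G (ctl s x).
Proof.
pose u (y : blocks a B0) := [ffun p : 'I_a * 'I_B0 => y p.1 p.2].
apply: (@lens_sum_get _ _ (ctl s) (fun x y => push (ctl_coord s) x (u y))).
  move=> x y; rewrite /ctl pull_push; last exact: ctl_coord_inj.
  by apply/ffunP=> j; apply/ffunP=> c; rewrite !ffunE.
move=> x y; have -> : u (ctl s x) = pull (ctl_coord s) x.
  by apply/ffunP=> -[j c]; rewrite !ffunE.
by apply: push_pull; apply: ctl_coord_inj.
Qed.

(* [mode = false] gives the functions close to unate, [mode = true] those far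
   from unate; a term [T i] alone satisfied by the control bits selects the
   action function, a constant or a majority up to the sign [b i]. *)
Definition hard (mode : bool) (s : shift) (b : cube N) : boolfun n :=
  [ffun x => [|| ~~ window (ctl s x), 1 < nsat T (ctl s x) |
     [exists i, [&& sat (T i) (ctl s x), ~~ mid m k (act s x) &
                    b i (+) (mode && maj m (act s x))]]]].

(** Drops the exception for the middle layers, the only obstacle to monotonicity in the yes-case. *)
Definition hard_monotone (s : shift) (b : cube N) : boolfun n :=
  [ffun x => [|| ~~ window (ctl s x), 1 < nsat T (ctl s x) |
     [exists i, sat (T i) (ctl s x) && b i]]].

Lemma sat_le t (y y' : blocks a B0) : (forall j c, y j c -> y' j c) -> sat t y -> sat t y'.
Proof. by move=> h /forallP st; apply/forallP=> j; apply: h. Qed.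

(** Leaving the window, satisfying two terms and satisfying a given term are all increasing in the
    control bits. *)
Lemma hard_monotone_unate s b : unate (hard_monotone s b).
Proof.
apply/existsP; exists [ffun=> false]; apply/forallP=> x'; apply/forallP=> y'.
have x0 (x : cube n) : cube_xor x [ffun=> false] = x.
  by apply/ffunP=> i; rewrite !ffunE addbF.
rewrite !x0; apply/implyP=> /forallP le; rewrite !ffunE.
have cle j c : ctl s x' j c -> ctl s y' j c.
  by rewrite !ffunE => h; have := le (ctl_coord s (j, c)); rewrite h.
apply/implyP=> /or3P[h|h|/existsP[i /andP[h bi]]]; apply/or3P.
- constructor 1; move: h; rewrite /window -!ltnNge => /leq_trans; apply.
  rewrite leq_mul2l; apply/orP; right; apply: leq_prod => j _; rewrite ltnS.
  by apply: leq_sum => c _; have := cle j c; case: (ctl s x' j c) => // ->.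
- constructor 2; apply: leq_trans h _; apply: leq_sum => i _.
  by have := @sat_le (T i) _ _ cle; case: (sat _ (ctl s x')) => // ->.
- by constructor 3; apply/existsP; exists i; rewrite (sat_le cle h).
Qed.

Lemma hard_yes_close s b :
  2 ^ a * \sum_x (hard false s b x != hard_monotone s b x) <=
  #|cube n| * \sum_(z : cube a) mid m k z.
Proof.
rewrite (sum_act s) leq_mul2l; apply/orP; right; apply: leq_sum => x _.
rewrite !ffunE; case: (mid _ _ _) => /=; first by case: (_ != _).
by under [X in (_ == [|| _, _ | X])]eq_existsb => i do [rewrite -[b i]addbF]; rewrite eqxx.
Qed.

Definition mass (i : 'I_N) := \sum_y [&& window y, nsat T y == 1 & sat (T i) y].

(** Over a control assignment selecting [i], the function is, up to the middle layers, negated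
    majority if [b i] holds and majority otherwise. The former conflicts with the directions in
    which [g] increases, the latter with those in which it decreases. *)
Lemma hard_no_far_aux s (b : cube N) (g : boolfun n) (r : cube n) :
  let e := \sum_(z : cube a) mid m k z in
  let flips (P : pred 'I_a) := \sum_(z : cube a) (maj m z != maj m (flip_on P z)) in
  let p1 := \sum_i b i * mass i in let p0 := \sum_i (~~ b i) * mass i in
  inc_on [pred i | ~~ r i] g -> dec_on [pred i | r i] g ->
  #|cube n| * (p1 * flips [pred j | ~~ r (act_coord s j)] +
               p0 * flips [pred j | r (act_coord s j)]) <=
  #|blocks a B0| * (2 * (2 ^ a * \sum_x (hard true s b x != g x))) +
  #|cube n| * (2 * e * (p1 + p0)).
Proof.
move=> e flips p1 p0 ginc gdec.
set k0 := flips _; set k1 := flips _.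
pose w (i : 'I_N) y := [&& window y, nsat T y == 1 & sat (T i) y].
pose u (c : pred 'I_N) y := \sum_i c i * w i y.
have uE (c : pred 'I_N) : \sum_i c i * mass i = \sum_y u c y.
  by rewrite /u exchange_big /=; apply: eq_bigr => i _; rewrite big_distrr.
have P1 : p1 = \sum_y u (fun i => b i) y by rewrite -uE.
have P0 : p0 = \sum_y u (fun i => ~~ b i) y by rewrite -uE.
have -> : #|cube n| * (p1 * k0 + p0 * k1) =
   #|blocks a B0| * \sum_x (u (fun i => b i) (ctl s x) * k0 + u (fun i => ~~ b i) (ctl s x) * k1).
  rewrite -(sum_ctl s (fun y => u (fun i => b i) y * k0 + u (fun i => ~~ b i) y * k1)).
  by rewrite big_split /= -!big_distrl /= -P1 -P0.
have -> : #|cube n| * (2 * e * (p1 + p0)) =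
   #|blocks a B0| * \sum_x (2 * e * (u (fun i => b i) (ctl s x) + u (fun i => ~~ b i) (ctl s x))).
  rewrite -(sum_ctl s (fun y => 2 * e * (u (fun i => b i) y + u (fun i => ~~ b i) y))).
  by rewrite -big_distrr /= big_split /= -P1 -P0.
rewrite -mulnDr leq_mul2l; apply/orP; right.
(* Resampling the action bits allows a comparison on each fibre where all other coordinates are
   fixed. *)
rewrite -(sum_act_push s (fun x => hard true s b x != g x)) big_distrr -big_split /=.
apply: leq_sum => x _; set y := ctl s x.
case: (boolP (window y && (nsat T y == 1))) => hy; last first.
  have u0 c : u c y = 0.
    by rewrite /u big1 // => i _; rewrite /w andbA (negbTE hy) muln0.
  by rewrite !u0.
case/andP: hy => wy ny.
have [i0 si0 sun] : exists2 i0, sat (T i0) y & forall i, sat (T i) y -> i = i0.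
  move: ny; rewrite /nsat => /eqP ny.
  have [i0 si0|no] := pickP (fun i => sat (T i) y); last first.
    by move: ny; rewrite big1 // => i _; rewrite no.
  exists i0 => // i si; apply/eqP; apply: contraT => ii0.
  by move: ny; rewrite (bigD1 i0) //= (bigD1 i) //= si0 si.
have uc (c : pred 'I_N) : u c y = c i0.
  rewrite /u (bigD1 i0) //= /w wy ny si0 muln1 big1 ?addn0 // => i ii0.
  case si: (sat (T i) y); last by rewrite muln0.
  by rewrite (sun i si) eqxx in ii0.
pose G (z : cube a) := g (push (act_coord s) x z).
have hE z : hard true s b (push (act_coord s) x z) = ~~ mid m k z && (b i0 (+) maj m z).
  rewrite ffunE ctl_push act_push -/y wy (eqP ny) /=.
  apply/existsP/idP => [[i /andP[/sun ->]] //|h].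
  by exists i0; rewrite si0.
have Ginc : inc_on [pred j | ~~ r (act_coord s j)] G.
  by move=> j z rj; rewrite /G !push_setb //; [exact: ginc | exact: act_coord_inj..].
have Gdec : dec_on [pred j | r (act_coord s j)] G.
  by move=> j z rj; rewrite /G !push_setb //; [exact: gdec | exact: act_coord_inj..].
rewrite !uc; case bi: (b i0); rewrite /= mul1n mul0n ?addn0 ?add0n muln1.
  apply: leq_trans (inc_maj_neg_dist Ginc) _; rewrite -mulnDr leq_mul2l /=.
  rewrite /e -big_split /=; apply: leq_sum => z _; rewrite hE bi -/(G z).
  by case: (mid _ _ _); case: (maj _ _); case: (G z).
apply: leq_trans (dec_maj_dist Gdec) _; rewrite -mulnDr leq_mul2l /=.
rewrite /e -big_split /=; apply: leq_sum => z _; rewrite hE bi -/(G z).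
by case: (mid _ _ _); case: (maj _ _); case: (G z).
Qed.

(** For any orientation the two flip counts total nearly [2^a] by [maj_flip_sum], and each is
    weighted by at least a quarter of the unique mass. *)
Lemma hard_no_far s (b : cube N) (g : boolfun n) :
  unate g ->
  200 * (\sum_(z : cube a) mid m k z) <= 2 ^ a ->
  #|blocks a B0| <= 8 * unique_mass T ->
  unique_mass T <= 4 * \sum_i b i * mass i ->
  unique_mass T <= 4 * \sum_i (~~ b i) * mass i ->
  #|cube n| < 100 * \sum_x (hard true s b x != g x).
Proof.
move=> /unate_oriented[r [ginc gdec]] he hY hp1 hp0.
have := @hard_no_far_aux s b g r ginc gdec.
have := @maj_flip_sum m k [ffun j => r (act_coord s j)].
have eP (P Q : pred 'I_a) : P =1 Q ->
    \sum_(z : cube a) (maj m z != maj m (flip_on P z)) =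
    \sum_(z : cube a) (maj m z != maj m (flip_on Q z)).
  by move=> PQ; apply: eq_bigr => z _; congr (_ != maj _ _); apply/ffunP=> i; rewrite !ffunE PQ.
rewrite (@eP _ [pred j | ~~ r (act_coord s j)]); last by move=> j /=; rewrite ffunE.
rewrite (@eP [pred i | _ i] [pred j | r (act_coord s j)]); last by move=> j /=; rewrite ffunE.
have hV : (\sum_i b i * mass i) + (\sum_i (~~ b i) * mass i) = unique_mass T.
  rewrite unique_mass_split -big_split; apply: eq_bigr => i _ /=.
  by rewrite -mulnDl; case: (b i); rewrite mul1n.
have Y0 : 0 < #|blocks a B0| by rewrite card_blocks !expn_gt0.
have A0 : 0 < 2 ^ a by rewrite expn_gt0.
have X0 : 0 < #|cube n| by rewrite card_cube expn_gt0.
move: he hY hp1 hp0 hV; set e := \sum_z mid m k z; set D := \sum_x (hard true s b x != g x); set V := unique_mass T.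
set p1 := \sum_i b i * mass i; set p0 := \sum_i (~~ b i) * mass i.
move=> he hY hp1 hp0 hV; set k0 := \sum_z (_ != _); set k1 := \sum_z (_ != _) => hk.
rewrite /= hV => h.
move: Y0 A0 X0 h hk he hY hp1 hp0 hV.
move: #|blocks a B0| (2 ^ a) #|cube n| e D V p1 p0 k0 k1; clear.
move=> Y A X e D V p1 p0 k0 k1 Y0 A0 X0 h hk he hY hp1 hp0 hV.
have s1 : V * (A - e) <= 4 * (p1 * k0 + p0 * k1).
  apply: (@leq_trans (V * (k0 + k1))); first by rewrite leq_mul2l; apply/orP; right; lia.
  have := leq_mul hp1 (leqnn k0); have := leq_mul hp0 (leqnn k1).
  by clear; nia.
have s2 : 199 * A <= 200 * (A - e) by lia.
rewrite ltnNge; apply/negP => hD.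
have s3 : X * (V * (A - e)) <= Y * (8 * (A * D)) + X * (8 * e * V).
  have := leq_mul (leqnn (4 * X)) (leqnn (p1 * k0 + p0 * k1)).
  have := leq_mul (leqnn X) s1; move: h; lia.
have s4 : Y * (8 * (A * D)) * 100 <= 64 * V * A * X.
  apply: (@leq_trans (Y * (8 * A) * X)); last first.
    by have := leq_mul (leq_mul hY (leqnn (8 * A))) (leqnn X); lia.
  by have := leq_mul (leqnn (Y * (8 * A))) hD; lia.
have VX : 0 < V * X by rewrite muln_gt0 X0 andbT; lia.
have s5 : V * X * (100 * (A - e)) <= V * X * (64 * A + 800 * e) by lia.
(* As [200 * e <= A], the left side is at least [99.5 A] and the right side at most [68 A]. *)
rewrite leq_pmul2l // in s5; lia.
Qed.
End Hard.

(** * Collisions *)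

Section Collision.
Variables (m k B0 N n : nat).
Local Notation a := m.*2.
Variable T : 'I_N -> term a B0.
Variable iota : 'I_a * 'I_B0.+1 -> 'I_n.

Local Notation act := (@act m B0 n iota).
Local Notation ctl := (@ctl m B0 n iota).
Local Notation shift := (shift m B0).

(** Counted over whole blocks, hence independent of the shift. *)
Definition common (x x' : cube n) j := \sum_e (x (iota (j, e)) && x' (iota (j, e))).
Definition differ (x x' : cube n) j := \sum_e (x (iota (j, e)) != x' (iota (j, e))).

Lemma common_le_window s x j : common x x j <= (wt (ctl s x j)).+1.
Proof.
rewrite /common (reindex_inj (GRing.addrI (s j))) big_ord_recl /= -[X in _ <= X]add1n.
apply: leq_add; first by case: (_ && _).
by apply: leq_sum => c _; rewrite andbb !ffunE.
Qed.

Lemma prod_common_window s x : window (ctl s x) ->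
  2 ^ a * \prod_j common x x j <= 16 * B0.+1 ^ a.
Proof.
apply: leq_trans; rewrite leq_mul2l; apply/orP; right.
by apply: leq_prod => j _; apply: common_le_window.
Qed.

(** With [K] common ones and [al], [be] private ones, [(K + al)(K + be) >= K^2 + K(al + be)]; then
    [K <= B0.+1] is used. *)
Lemma common_differ x x' j :
  common x x' j ^ 2 * (B0.+1 + differ x x' j) <= common x x j * common x' x' j * B0.+1.
Proof.
pose al := \sum_e (x (iota (j, e)) && ~~ x' (iota (j, e))).
pose be := \sum_e (~~ x (iota (j, e)) && x' (iota (j, e))).
have -> : common x x j = common x x' j + al.
  rewrite /common /al -big_split; apply: eq_bigr => e _ /=.
  by case: (x _); case: (x' _).
have -> : common x' x' j = common x x' j + be.
  rewrite /common /be -big_split; apply: eq_bigr => e _ /=.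
  by case: (x _); case: (x' _).
have -> : differ x x' j = al + be.
  rewrite /differ /al /be -big_split; apply: eq_bigr => e _ /=.
  by case: (x _); case: (x' _).
have : common x x' j <= B0.+1.
  rewrite -[X in _ <= X]card_ord -sum1_card; apply: leq_sum => e _; by case: (_ && _).
move: (common _ _ _) al be (B0.+1); clear => K al be B KB.
have := leq_mul (leqnn (K * (al + be))) KB; rewrite -mulnn => h.
have -> : (K + al) * (K + be) * B = K * K * B + K * (al + be) * B + al * be * B by ring.
have -> : K * K * (B + (al + be)) = K * K * B + K * (al + be) * K by ring.
by apply: leq_trans (leq_addr _ _); rewrite leq_add2l.
Qed.

Lemma prod_common_differ x x' :
  (\prod_j common x x' j) ^ 2 * \prod_j (B0.+1 + differ x x' j) <=
  (\prod_j common x x j) * (\prod_j common x' x' j) * B0.+1 ^ a.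
Proof.
rewrite -mulnn (expn_prod B0.+1) -!big_split /=; apply: leq_prod => j _.
by rewrite mulnn common_differ.
Qed.

Lemma sum_sat_shift t x x' :
  \sum_(s : shift) (sat t (ctl s x) && sat t (ctl s x')) = \prod_j common x x' j.
Proof.
under eq_bigr => s _.
  have -> : sat t (ctl s x) && sat t (ctl s x') =
     \prod_j (x (iota (j, (s j + lift ord0 (t j))%R)) &&
              x' (iota (j, (s j + lift ord0 (t j))%R))) :> nat.
    rewrite -nat_forall; congr nat_of_bool; apply/andP/forallP.
      move=> [/forallP h /forallP h'] j.
      by have := h j; have := h' j; rewrite !ffunE => -> ->.
    by move=> h; split; apply/forallP=> j; rewrite !ffunE; case/andP: (h j).
over.
rewrite -(bigA_distr_bigA (fun j e => nat_of_bool (x (iota (j, (e + lift ord0 (t j))%R)) &&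
              x' (iota (j, (e + lift ord0 (t j))%R))))) /=.
apply: eq_bigr => j _.
by rewrite /common [RHS](reindex_inj (GRing.addIr (lift ord0 (t j)))).
Qed.

(** An exponential moment, which factors because the action positions are independent; a block
    contributes 2 at each differing position and 1 elsewhere. *)
Lemma sum_exp_differ x x' :
  \sum_(s : shift) 2 ^ (\sum_j (act s x j != act s x' j)) =
  \prod_j (B0.+1 + differ x x' j).
Proof.
under eq_bigr => s _.
  rewrite (big_morph (fun d => 2 ^ d) (fun d d' => expnD 2 d d') (erefl : 2 ^ 0 = 1)).
  under eq_bigr => j _ do rewrite !ffunE.
over.
rewrite -(bigA_distr_bigA (fun j e => 2 ^ (x (iota (j, e)) != x' (iota (j, e))))) /=.
apply: eq_bigr => j _.
rewrite -[X in _ = X + _]card_ord -sum1_card /differ -big_split /=.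
by apply: eq_bigr => e _; case: (_ != _).
Qed.

Definition collide (s : shift) (x x' : cube n) :=
  [&& window (ctl s x), window (ctl s x'),
      [exists i, sat (T i) (ctl s x) && sat (T i) (ctl s x')],
      wt (act s x) + k < m & m + k < wt (act s x')].

Lemma collide_differ s x x' : collide s x x' ->
  k.*2 <= \sum_j (act s x j != act s x' j).
Proof.
case/and5P=> _ _ _ h1 h2.
have : wt (act s x') <= wt (act s x) + \sum_j (act s x j != act s x' j).
  rewrite /wt -big_split /=; apply: leq_sum => j _.
  by case: (act s x j); case: (act s x' j).
lia.
Qed.

(* With V = prod_j (1 + differ_j / B), a common term has probability at most
   8 V^(-1/2) and a jump over the middle layers at most 4^(-k) V. *)
Lemma sum_collide l x x' : k = l.*2 -> 2 * N = 2 ^ a ->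
  2 ^ l * \sum_(s : shift) collide s x x' <= 8 * B0.+1 ^ a.
Proof.
move=> kl N2.
(* One colliding shift gives both window bounds, because [common x x] does not depend on the
   shift. *)
have [[s0 hs0]|none] : (exists s, collide s x x') \/ (forall s, collide s x x' = false).
- case: (pickP (fun s : shift => collide s x x')) => [s hs|h]; first by left; exists s.
  by right.
- have w1 : 2 ^ a * \prod_j common x x j <= 16 * B0.+1 ^ a.
    by apply: (@prod_common_window s0); case/and5P: hs0.
  have w2 : 2 ^ a * \prod_j common x' x' j <= 16 * B0.+1 ^ a.
    by apply: (@prod_common_window s0); case/and5P: hs0.
  have c1 : \sum_(s : shift) collide s x x' <= N * \prod_j common x x' j.
    rewrite -[X in X * _]card_ord -sum_nat_const.
    under [X in _ <= X]eq_bigr => i _ do rewrite -(sum_sat_shift (T i)).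
    rewrite exchange_big /=; apply: leq_sum => s _.
    case: (boolP (collide s x x')) => // /and5P[_ _ /existsP[i hi] _ _].
    by rewrite (bigD1 i) //= hi.
  have c2 : 2 ^ (k.*2) * \sum_(s : shift) collide s x x' <= \prod_j (B0.+1 + differ x x' j).
    rewrite -sum_exp_differ big_distrr /=; apply: leq_sum => s _.
    case: (boolP (collide s x x')) => [h|_]; rewrite ?muln0 // muln1 leq_exp2l //.
    exact: collide_differ h.
  have kd := prod_common_differ x x'.
  have B1 : 0 < B0.+1 ^ a by rewrite expn_gt0.
  have L0 : 0 < 2 ^ l by rewrite expn_gt0.
  have k4 : 2 ^ (k.*2) = 2 ^ l * 2 ^ l * (2 ^ l * 2 ^ l).
    by rewrite kl -!expnD; congr (2 ^ _); lia.
  move: c1 c2 w1 w2 kd B1 L0; rewrite k4 -N2.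
  move: (\sum_s _) (\prod_j common x x' j) (\prod_j common x x j)
    (\prod_j common x' x' j) (\prod_j (_ + _)) (B0.+1 ^ a) (2 ^ l); clear.
  move=> S K X X' V B L c1 c2 w1 w2 kd B1 L0.
  (* Above this threshold sharing a term is rare; below it, crossing the middle layers is rare. *)
  case: (leqP (L * L * B) V) => hV.
    have e1 : (2 * N * (L * K)) ^ 2 <= (16 * B) ^ 2.
      have : (2 * N) ^ 2 * (K ^ 2 * (L * L * B)) <= (2 * N * X) * (2 * N * X') * B.
        have -> : (2 * N * X) * (2 * N * X') * B = (2 * N) ^ 2 * (X * X' * B) by ring.
        rewrite leq_mul2l; apply/orP; right; apply: leq_trans kd.
        by rewrite leq_mul2l hV orbT.
      have := leq_mul (leq_mul w1 w2) (leqnn B) => h1 h2.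
      have := leq_trans h2 h1.
      have -> : (2 * N) ^ 2 * (K ^ 2 * (L * L * B)) = (2 * N * (L * K)) ^ 2 * B by ring.
      by rewrite leq_pmul2r //; rewrite mulnn.
    rewrite leq_sqr in e1.
    have := leq_mul (leqnn L) c1; lia.
  have e2 : L * L * (L * L * S) <= L * L * B by rewrite mulnA; apply: leq_trans c2 (ltnW hV).
  rewrite leq_pmul2l ?muln_gt0 ?L0 // in e2.
  have : L * S <= L * L * S by rewrite -mulnA leq_pmull.
  lia.
by rewrite big1 ?muln0 // => s _; rewrite none.
Qed.

Definition collides (s : shift) (Q : seq (cube n)) :=
  has (fun x => has (collide s x) Q) Q.

Lemma sum_collides l Q : k = l.*2 -> 2 * N = 2 ^ a ->
  2 ^ l * \sum_(s : shift) collides s Q <= size Q ^ 2 * (8 * B0.+1 ^ a).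
Proof.
move=> kl N2.
have has_sum (P : pred (cube n)) R : has P R <= \sum_(x <- R) P x.
  elim: R => [|x R IH] /=; first by rewrite big_nil.
  by rewrite big_cons; case: (P x) => //=; rewrite leq_addr.
apply: (@leq_trans (2 ^ l * \sum_(s : shift) \sum_(x <- Q) \sum_(x' <- Q) collide s x x')).
  rewrite leq_mul2l; apply/orP; right; apply: leq_sum => s _.
  by apply: leq_trans (has_sum _ _) _; apply: leq_sum => x _; apply: has_sum.
rewrite exchange_big /=; under eq_bigr => x _ do rewrite exchange_big /=.
rewrite big_distrr /=; under eq_bigr => x _ do rewrite big_distrr /=.
apply: (@leq_trans (\sum_(x <- Q) \sum_(x' <- Q) 8 * B0.+1 ^ a)).
  by apply: leq_sum => x _; apply: leq_sum => x' _; apply: sum_collide.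
by rewrite !big_const_seq !count_predT !iter_addn !addn0; apply: eq_leq; ring.
Qed.

(* If no two queries collide, flipping [b i] for the terms [i] met by a query
   above the middle layers turns one function into the other on [Q]. *)
Lemma hard_indistinguishable s Q : ~~ collides s Q ->
  exists r : cube N, forall (b : cube N) x, x \in Q ->
    hard k T iota false s b x = hard k T iota true s (cube_xor b r) x.
Proof.
move=> /hasPn nc.
exists [ffun i => has (fun x => [&& window (ctl s x), sat (T i) (ctl s x) & m + k < wt (act s x)]) Q].
move=> b x xQ; rewrite !ffunE; case wx: (window _) => //=; congr (_ || _).
apply: eq_existsb => i; case si: (sat _ _) => //=; case mz: (mid _ _ _) => //=.
rewrite addbF !ffunE /maj.
have [hi|lo] : m + k < wt (act s x) \/ wt (act s x) + k < m.
- by move/negbT: mz; rewrite /mid negb_and -!ltnNge => /orP[]; [right|left].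
- have -> : has (fun x => [&& window (ctl s x), sat (T i) (ctl s x) & m + k < wt (act s x)]) Q.
    by apply/hasP; exists x; rewrite // wx si.
  have -> : m < wt (act s x) by apply: leq_ltn_trans hi; apply: leq_addr.
  by case: (b i).
have -> : has (fun x => [&& window (ctl s x), sat (T i) (ctl s x) & m + k < wt (act s x)]) Q = false.
  apply/hasP=> -[x' x'Q /and3P[w' s' h']]; have /hasPn/(_ x' x'Q) := nc x xQ.
  by rewrite /collide wx w' lo h' /= andbT; case/existsP; exists i; rewrite si.
by rewrite addbF ltnNge; case: leqP; rewrite ?addbF //; lia.
Qed.
End Collision.

Import Order.TTheory GRing.Theory Num.Theory.
Local Open Scope ring_scope.

(** * The query lower bound *)

Section Distance.
Variables (R : realType) (n : nat).

Lemma dist_sum (f g : boolfun n) :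
  dist R f g = (\sum_x (f x != g x))%N%:R / #|cube n|%:R.
Proof. by rewrite /dist card_pred_sum. Qed.

Lemma card_cube_gt0 : 0 < #|cube n|%:R :> R.
Proof. by rewrite card_cube ltr0n expn_gt0. Qed.

Lemma dist_to_le (P : pred (boolfun n)) (f g : boolfun n) (c d : nat) : (0 < d)%N -> P g ->
  (d * \sum_x (f x != g x) <= c * #|cube n|)%N -> dist_to R P f <= c%:R / d%:R.
Proof.
move=> d0 Pg h; apply: le_trans (bigmin_le_cond 1 (dist R f) Pg) _.
rewrite dist_sum ler_pdivrMr ?card_cube_gt0 // mulrAC ler_pdivlMr ?ltr0n //.
by rewrite -!natrM ler_nat mulnC.
Qed.

Lemma dist_to_gt (P : pred (boolfun n)) (f : boolfun n) (c d : nat) : (0 < d)%N -> (c < d)%N ->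
  (forall g, P g -> (c * #|cube n| < d * \sum_x (f x != g x))%N) ->
  c%:R / d%:R < dist_to R P f.
Proof.
move=> d0 cd h; rewrite /dist_to; apply: lt_bigmin => [|g /h {}h].
  (* The default value 1 of the minimum exceeds the bound because [c < d]. *)
  by rewrite ltr_pdivrMr ?ltr0n // mul1r ltr_nat.
rewrite dist_sum ltr_pdivlMr ?card_cube_gt0 // mulrAC ltr_pdivrMr ?ltr0n //.
by rewrite -!natrM ltr_nat [X in (_ < X)%N]mulnC.
Qed.
End Distance.

Section Tester.
Variables (R : realType) (n : nat) (A : nonadaptive_algo R n).

Lemma pr_acceptE f : pr_accept A f = \sum_(w : seed A) weight w * (accepts f w : nat)%:R.
Proof.
rewrite /pr_accept big_mkcond; apply: eq_bigr => w _.
by case: (accepts f w); rewrite ?mulr1 ?mulr0.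
Qed.

Lemma pr_accept_reject f : pr_accept A f + pr_reject A f = 1.
Proof. by rewrite -(weight_sum1 A) [RHS](bigID (accepts f)). Qed.

Lemma pr_accept_le1 f : pr_accept A f <= 1.
Proof.
rewrite -(pr_accept_reject f) lerDl; apply: sumr_ge0 => w _; apply: weight_ge0.
Qed.
End Tester.

Section LowerBound.
Variables (R : realType) (n m k l B0 N : nat) (A : nonadaptive_algo R n).
Local Notation a := m.*2.
Variable T : 'I_N -> term a B0.
Variable iota : 'I_a * 'I_B0.+1 -> 'I_n.
Hypotheses (iota_inj : injective iota) (kl : k = l.*2) (N2 : (2 * N = 2 ^ a)%N).
Hypothesis mid_small : (200 * (\sum_(z : cube a) mid m k z) <= 2 ^ a)%N.
Hypothesis T_unique : (#|blocks a B0| <= 8 * unique_mass T)%N.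
Hypothesis a_large : (5 <= m)%N.
Hypothesis tester : tolerant_tester (1 / 200 : R) (1 / 100) (@unate n) A.

Local Notation hard := (hard k T iota).
Local Notation shift := (shift m B0).

Definition unbalanced (b : cube N) :=
  ((4 * \sum_i b i * mass T i < unique_mass T) ||
   (4 * \sum_i (~~ b i) * mass T i < unique_mass T))%N.

(** One term holds on a share [2^(-a)] of the control assignments, so it has at most [2^(3-a)] of
    the unique mass, and [balanced_split] applies with [C = 2^(a-3)]. As [a >= 10], [4 / C] is below
    [1/12]. *)
Lemma sum_unbalanced : (12 * \sum_b unbalanced b <= 2 ^ N)%N.
Proof.
have V0 : (0 < unique_mass T)%N.
  by have : (0 < #|blocks a B0|)%N by [rewrite card_blocks !expn_gt0]; lia.
have VE : unique_mass T = (\sum_i mass T i)%N := unique_mass_split T.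
have := @balanced_split N (mass T) (2 ^ (a - 3)).
rewrite -VE => /(_ V0) h; have {h} : (2 ^ (a - 3) * \sum_b unbalanced b <= 4 * 2 ^ N)%N.
  apply: h => i; have h : (2 ^ a * mass T i <= #|blocks a B0|)%N.
    rewrite -(sum_sat (T i)) leq_mul2l; apply/orP; right; apply: leq_sum => y _.
    by case: (sat _ _); rewrite ?andbF //; case: (_ && _).
  rewrite -(@leq_pmul2l 8) //; apply: leq_trans T_unique; apply: leq_trans h.
  rewrite mulnA leq_mul2r; apply/orP; right; rewrite -[8%N]/(2 ^ 3)%N -expnD leq_exp2l //; lia.
move=> h.
have e48 : (48 <= 2 ^ (a - 3))%N.
  by apply: (@leq_trans (2 ^ 6)); rewrite // leq_exp2l //; lia.
have := leq_mul e48 (leqnn (\sum_b unbalanced b)); lia.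
Qed.

Lemma hard_yes_accept s b : 2 / 3 <= pr_accept A (hard false s b).
Proof.
apply: (tester (hard false s b)).1.
apply: (@dist_to_le _ _ _ _ (hard_monotone T iota s b) 1 200) => //.
  exact: hard_monotone_unate.
have h := hard_yes_close k T iota_inj s b.
rewrite mul1n -(@leq_pmul2l (2 ^ a)) ?expn_gt0 // mulnCA.
apply: leq_trans (leq_mul (leqnn 200) h) _; rewrite mulnCA mulnC leq_mul2r.
by rewrite mid_small orbT.
Qed.

Lemma hard_no_accept s b : pr_accept A (hard true s b) <= 1 / 3 + (unbalanced b)%:R.
Proof.
case: (boolP (unbalanced b)) => [_|hb].
  by apply: le_trans (pr_accept_le1 _ _) _; rewrite mulr1n; lra.
move: hb; rewrite negb_or -!leqNgt => /andP[hb1 hb0].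
have : 1 / 100 < dist_to R (@unate n) (hard true s b).
  apply: (@dist_to_gt _ _ _ _ 1 100) => // g gu; rewrite mul1n.
  exact: (hard_no_far iota_inj s gu mid_small T_unique hb1 hb0).
move/(tester (hard true s b)).2; have := pr_accept_reject A (hard true s b); rewrite mulr0n; lra.
Qed.

(** A fixed seed fixes the queries. Without collision, translating [b] matches the acceptance
    counts; a colliding shift costs at most all [2^N] sign vectors. *)
Lemma sum_accepts_gap (w : seed A) :
  (2 ^ l * \sum_(s : shift) \sum_b accepts (hard false s b) w <=
   2 ^ l * (\sum_(s : shift) \sum_b accepts (hard true s b) w) +
   2 ^ N * (num_queries A ^ 2 * (8 * B0.+1 ^ a)))%N.
Proof.
have h : (\sum_(s : shift) \sum_b accepts (hard false s b) w <=
   (\sum_(s : shift) \sum_b accepts (hard true s b) w) +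
   2 ^ N * \sum_(s : shift) collides k T iota s (queries w))%N.
  rewrite big_distrr -big_split /=; apply: leq_sum => s _.
  case: (boolP (collides _ _ _ _ _)) => [_|nc].
    rewrite muln1; apply: leq_trans (leq_addl _ _); rewrite -card_cube -sum1_card.
    by apply: leq_sum => b _; case: (accepts _ _).
  rewrite muln0 addn0; have [r hr] := hard_indistinguishable nc.
  have xor_inj : injective (fun b : cube N => cube_xor b r).
    by apply: inv_inj => b; apply/ffunP=> i; rewrite !ffunE addbK.
  rewrite [X in (_ <= X)%N](reindex_inj xor_inj) /=; apply: leq_sum => b _.
  rewrite /accepts; have -> // : [seq hard false s b x | x <- queries w] =
    [seq hard true s (cube_xor b r) x | x <- queries w].
  by apply/eq_in_map => x xQ; apply: hr.
have hc := sum_collides T iota (queries w) kl N2.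
apply: (@leq_trans (2 ^ l * (\sum_(s : shift) \sum_b accepts (hard true s b) w +
   2 ^ N * \sum_(s : shift) collides k T iota s (queries w)))).
  by rewrite leq_mul2l h orbT.
rewrite mulnDr leq_add2l mulnCA leq_mul2l; apply/orP; right; apply: leq_trans hc _.
rewrite leq_mul2r leq_sqr; apply/orP; right.
exact: (leq_bigmax_cond w).
Qed.

(** Yao's argument: on average over shifts and signs, acceptance is at least [2/3] in the yes-case
    and at most [1/3 + 1/12] in the no-case. The gap [1/4] is at most [8 q^2 / 2^l] for [q]
    queries. *)
Lemma queries_sqr_ge : (2 ^ l <= 32 * num_queries A ^ 2)%N.
Proof.
pose avg mode := \sum_(s : shift) \sum_b pr_accept A (hard mode s b).
have avgE mode : avg mode = \sum_(w : seed A) weight w *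
    (\sum_(s : shift) \sum_b accepts (hard mode s b) w)%N%:R.
  rewrite /avg; under eq_bigr do under eq_bigr do rewrite pr_acceptE.
  under eq_bigr do rewrite exchange_big /=; rewrite exchange_big /=.
  apply: eq_bigr => w _; rewrite natr_sum mulr_sumr; apply: eq_bigr => s _.
  by rewrite natr_sum mulr_sumr.
have cS : #|shift| = (B0.+1 ^ a)%N by rewrite card_ffun !card_ord.
set S : R := (B0.+1 ^ a)%N%:R; set M : R := (2 ^ N)%N%:R.
have S0 : 0 < S by rewrite ltr0n expn_gt0.
have M0 : 0 < M by rewrite ltr0n expn_gt0.
have yes : S * (M * (2 / 3)) <= avg false.
  apply: le_trans (_ : \sum_(s : shift) \sum_(b : cube N) (2 / 3 : R) <= _).
    by rewrite !sumr_const cS card_cube -[X in _ <= X]mulr_natl -[X in _ <= _ * X]mulr_natl.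
  by apply: ler_sum => s _; apply: ler_sum => b _; apply: hard_yes_accept.
have no : avg true <= S * (M * (1 / 3 + 1 / 12)).
  apply: le_trans (_ : \sum_(s : shift) M * (1 / 3 + 1 / 12) <= _); last first.
    by rewrite sumr_const cS -[X in X <= _]mulr_natl.
  apply: ler_sum => s _.
  apply: le_trans (_ : _ <= \sum_(b : cube N) (1 / 3 + (unbalanced b)%:R)) _.
    by apply: ler_sum => b _; apply: hard_no_accept.
  rewrite big_split /= sumr_const card_cube -mulr_natl -natr_sum.
  have : 12 * (\sum_b unbalanced b)%N%:R <= M by rewrite -natrM ler_nat sum_unbalanced.
  rewrite /M; lra.
have gap : (2 ^ l)%N%:R * avg false <= (2 ^ l)%N%:R * avg true +
    M * ((num_queries A ^ 2)%N%:R * (8 * S)).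
  set c := M * _; have -> : c = \sum_(w : seed A) weight w * c.
    by rewrite -mulr_suml weight_sum1 mul1r.
  rewrite !avgE !mulr_sumr -big_split /=.
  apply: ler_sum => w _; rewrite !(mulrCA _ (weight w)) -mulrDr.
  apply: ler_wpM2l; first exact: weight_ge0.
  by rewrite /c /S /M -!natrM -natrD ler_nat; apply: sum_accepts_gap.
have L0 : 0 < (2 ^ l)%N%:R :> R by rewrite ltr0n expn_gt0.
have h1 := ler_wpM2l (ltW L0) yes; have h2 := ler_wpM2l (ltW L0) no.
have SM : 0 < S * M by apply: mulr_gt0.
have : (S * M) * (2 ^ l)%N%:R <= (S * M) * (32 * num_queries A ^ 2)%N%:R.
  rewrite natrM; move: h1 h2 gap; set L := (2 ^ l)%N%:R; set q := (num_queries A ^ 2)%N%:R.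
  move=> h1 h2 gap; nra.
by rewrite ler_pM2l // ler_nat.
Qed.
End LowerBound.

(** * Choice of parameters *)

Definition half_blocks (l : nat) : nat := (200 * l.*2.*2.+1) ^ 2.
(** The number [a * B0.+1] of coordinates in use when [B0 = 20 * a], of order [l^4]. *)
Definition grid_size (l : nat) : nat :=
  (half_blocks l).*2 * (20 * (half_blocks l).*2).+1.

(** With [k = 2l], [half_blocks l] is the square of [200(2k+1)], which brings the bound
    [(2k+1) / sqrt(2m+1)] below [1/200]. *)
Lemma mid_half_blocks l :
  (200 * \sum_(z : cube (half_blocks l).*2) mid (half_blocks l) l.*2 z
     <= 2 ^ (half_blocks l).*2)%N.
Proof.
have := sum_mid_sqr (half_blocks l) l.*2; set e := (\sum_z _)%N => h.
rewrite -leq_sqr -(@leq_pmul2l (l.*2.*2.+1 ^ 2)) ?expn_gt0 //.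
rewrite -(expnMn _ (2 ^ _)); apply: leq_trans h.
apply: (@leq_trans (e ^ 2 * half_blocks l)).
  by apply: eq_leq; rewrite /half_blocks !expnMn mulnC [RHS]mulnC; ring.
by rewrite leq_mul2l; apply/orP; right; rewrite -addnn; lia.
Qed.

(** For [t = l / (d+1)], split [2^l >= 2^t (2^t)^d]: the first factor absorbs the constants, the
    second the power. *)
Lemma exp_dominates C d : (0 < d)%N -> exists l0, forall l, (l0 <= l -> C * l.+1 ^ d <= 2 ^ l)%N.
Proof.
move=> d0; exists (d.+1 * (C * d.+1 ^ d))%N => l hl.
pose t := (l %/ d.+1)%N.
have tl : (t * d.+1 <= l)%N by rewrite /t leq_divM.
have lt : (l.+1 <= d.+1 * t.+1)%N by rewrite mulnC; apply: ltn_ceil.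
have ht : (C * d.+1 ^ d <= t)%N by rewrite /t leq_divRL // mulnC.
apply: (@leq_trans (C * (d.+1 ^ d * (2 ^ t) ^ d))).
  rewrite leq_mul2l -expnMn; apply/orP; right; rewrite leq_exp2r //.
  by apply: leq_trans lt _; rewrite leq_mul2l ltn_expl.
apply: leq_trans (_ : 2 ^ (t * d.+1) <= _)%N; last by rewrite leq_exp2l.
rewrite mulnA mulnS expnD expnM leq_mul2r; apply/orP; right.
by apply: leq_trans ht _; apply: ltnW; apply: ltn_expl.
Qed.

Lemma grid_size_bound : exists K, forall l, (grid_size l <= K * l.+1 ^ 4)%N.
Proof.
have [c h] : exists c, forall l, ((half_blocks l).*2 <= c * l.+1 ^ 2)%N.
  exists ((200 * 5) ^ 2 * 2)%N => l.
  by rewrite -muln2 mulnAC leq_mul2r -expnMn leq_sqr /=; lia.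
exists (c * (21 * c))%N => l.
apply: (@leq_trans ((half_blocks l).*2 * (21 * (half_blocks l).*2))).
  rewrite /grid_size leq_mul2l; apply/orP; right.
  by have : (0 < half_blocks l)%N by [rewrite expn_gt0]; lia.
have -> : (c * (21 * c) * l.+1 ^ 4 = c * l.+1 ^ 2 * (21 * (c * l.+1 ^ 2)))%N by ring.
by rewrite leq_mul // leq_mul2l h orbT.
Qed.

Lemma queries_grid (R : realType) n (A : nonadaptive_algo R n) l :
  (grid_size l <= n)%N -> tolerant_tester (1 / 200 : R) (1 / 100) (@unate n) A ->
  (2 ^ l <= 32 * num_queries A ^ 2)%N.
Proof.
move=> ln tA; pose m := half_blocks l; pose B0 := (20 * m.*2)%N.
have m5 : (5 <= m)%N.
  by rewrite /m /half_blocks; apply: (@leq_trans (200 ^ 2)); rewrite // leq_sqr leq_pmulr.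
pose N := (2 ^ m.*2.-1)%N.
have N2 : (2 * N = 2 ^ m.*2)%N by rewrite /N -expnS prednK // double_gt0; lia.
have B0p : (0 < B0)%N by rewrite /B0; lia.
have [T hT] := @exists_terms m.*2 B0 N B0p.
have cG : (#|{: 'I_m.*2 * 'I_B0.+1}| <= n)%N by rewrite card_prod !card_ord.
pose iota (p : 'I_m.*2 * 'I_B0.+1) : 'I_n := widen_ord cG (enum_rank p).
have iota_inj : injective iota.
  by move=> p q /(congr1 val) /= /ord_inj /enum_rank_inj.
have hU := @unique_mass_ge _ _ _ (fun i : 'I_N => T i) (leqnn B0) B0p N2 hT.
exact: (@queries_sqr_ge R n m l.*2 l B0 N A _ iota iota_inj erefl N2 (mid_half_blocks l) hU m5 tA).
Qed.

(** Take the largest [l] whose grid fits into [n] coordinates. Then [n] is [O((l+1)^4)], so [n^3] is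
    [O((l+1)^12)], eventually far below [2^l]. *)
Lemma queries_superpolynomial (R : realType) : exists N : nat, forall n (A : nonadaptive_algo R n),
  (N <= n)%N -> tolerant_tester (1 / 200 : R) (1 / 100) (@unate n) A ->
  (n ^ 3 <= num_queries A ^ 2)%N.
Proof.
have [K hK] := grid_size_bound.
have [l0 hl0] := @exp_dominates (32 * (K * 2 ^ 4) ^ 3) 12 isT.
exists (grid_size l0) => n A hn tA.
have ex : exists l, (grid_size l <= n)%N by exists l0.
have ub l : (grid_size l <= n)%N -> (l <= n)%N.
  apply: leq_trans; rewrite /grid_size /half_blocks -mulnn; nia.
case: (ex_maxnP ex ub) => l hl lmax.
have hn' : (n < grid_size l.+1)%N by rewrite ltnNge; apply/negP => /lmax; rewrite ltnn.
have l0l : (l0 <= l)%N by apply: lmax.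
have h := queries_grid hl tA; have h0 := hl0 l l0l.
rewrite -(@leq_pmul2l 32) //; apply: leq_trans h; apply: leq_trans h0.
rewrite -mulnA leq_mul2l /=.
have -> : (l.+1 ^ 12 = (l.+1 ^ 4) ^ 3)%N by rewrite -expnM.
rewrite -expnMn leq_exp2r //; apply: leq_trans (ltnW hn') _; apply: leq_trans (hK _) _.
rewrite -mulnA leq_mul2l -expnMn leq_exp2r //; apply/orP; right; lia.
Qed.

Theorem theorem1p5 (R : realType) :
  exists eps0 eps1 : R,
    [/\ 0 < eps0, eps0 < eps1 & eps1 < 1] /\
    exists (K c : R) (N : nat),
      [/\ 0 < K, 0 < c &
          forall (n : nat) (A : nonadaptive_algo R n),
            (N <= n)%N ->
            tolerant_tester eps0 eps1 (@unate n) A ->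
            K * (n%:R `^ (3 / 2) / (ln (n%:R `^ (3 / 2))) `^ c)
              <= (num_queries A)%:R].
Proof.
exists (1 / 200), (1 / 100); split; first by split; lra.
have [N hN] := queries_superpolynomial R.
(* The second bound on [n] gives [n >= e], so the logarithm is at least 1 and dividing by it only
   weakens the claim. *)
exists 1, 1, (maxn N (Num.truncn (expR 1 : R)).+1); split=> // n A.
rewrite geq_max => /andP[Nn en] tA; have h := hN n A Nn tA.
have en' : expR 1 <= n%:R :> R.
  by apply: le_trans (ltW (truncnS_gt _)) _; rewrite ler_nat.
have n0 : 0 < n%:R :> R by apply: lt_le_trans en'; apply: expR_gt0.
set y := n%:R `^ (3 / 2).
have y0 : 0 <= y by apply: powR_ge0.
have y2 : y ^+ 2 = n%:R ^+ 3.
  rewrite -(powR_mulrn 2 y0) /y -powRrM -(powR_mulrn 3 (ltW n0)); congr (_ `^ _).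
  by lra.
have lny : 1 <= ln y.
  rewrite /y ln_powR; have : 1 <= ln (n%:R : R).
    by rewrite -[X in X <= _](expRK 1) ler_ln // posrE ?expR_gt0.
  lra.
rewrite mul1r powRr1; last by lra.
apply: (@le_trans _ _ y).
  by rewrite ler_pdivrMr ?ler_peMr //; lra.
rewrite -(@ler_pXn2r _ 2) // ?nnegrE // y2 -!natrX ler_nat //.
Qed.
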